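(* Let $m\in\mathbb{N}$ and $s>0$. If the Crank-Nicolson method for the $m$-dimensional semi-discrete heat problem is positive for the CFL coefficient $s$ (that is, all entries of $A_m(s)$ are non-negative), then for that $s$ it is also contractive in the infinity norm and in the $1$-norm, that is, $\|A_m(s)\|_\infty\le1$ and $\|A_m(s)\|_1\le1$.
   Context: $\mathbb{N}=\{1,2,3,\dots\}$. The $m$-dimensional semi-discrete heat problem is $w'(t)=B_hw(t)$ with $B_h=h^{-2}\,\mathrm{tridiag}(1,-2,1)$ of dimension $m$ and $h=1/(m+1)$. The Crank-Nicolson method with time step $\tau>0$ is the iteration $w_n=A_m(s)w_{n-1}$, where $s=\tau/h^2$ is the CFL coefficient and $$A_m(s)=\left(I_m-\tfrac{\tau}{2}B_h\right)^{-1}\left(I_m+\tfrac{\tau}{2}B_h\right)=M_m(s)^{-1}N_m(s),$$ with $M_m(s)$ the $m\times m$ tridiagonal matrix with diagonal entries $1+s$ and sub- and super-diagonal entries $-s/2$, and $N_m(s)$ the $m\times m$ tridiagonal matrix with diagonal entries $1-s$ and sub- and super-diagonal entries $s/2$. The matrix norms are the induced ones: $\|A\|_\infty=\max_i\sum_j|a_{ij}|$ and $\|A\|_1=\max_j\sum_i|a_{ij}|$. *)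

(* Defs.v *)
From mathcomp Require Import all_boot all_order all_algebra.
From mathcomp Require Import reals.
From mathcomp Require Import ring.

Set Implicit Arguments.
Unset Strict Implicit.
Unset Printing Implicit Defensive.

Import Order.TTheory GRing.Theory Num.Theory.
Local Open Scope ring_scope.

(* tridiag(a, b, c): sub-diagonal a, diagonal b, super-diagonal c. *)
Definition tridiag (R : realType) (m : nat) (a b c : R) : 'M[R]_m :=
  \matrix_(i < m, j < m)
    if i == j then b
    else if (i == j.+1 :> nat) then a
    else if (j == i.+1 :> nat) then c
    else 0.

Definition mesh (R : realType) (m : nat) : R := (m.+1)%:R^-1.

Definition heat_mx (R : realType) (m : nat) : 'M[R]_m :=
  (mesh R m) ^- 2 *: tridiag m 1 (-2) 1.

Definition cn_step (R : realType) (m : nat) (tau : R) : 'M[R]_m :=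
  invmx (1%:M - (tau / 2) *: heat_mx R m) *m (1%:M + (tau / 2) *: heat_mx R m).

Definition cn_M (R : realType) (m : nat) (s : R) : 'M[R]_m :=
  tridiag m (- (s / 2)) (1 + s) (- (s / 2)).

Definition cn_N (R : realType) (m : nat) (s : R) : 'M[R]_m :=
  tridiag m (s / 2) (1 - s) (s / 2).

(* [invmx] is the identity on singular matrices; [cn_M_unit] below shows that
   it is only ever applied to an invertible matrix here.  [cn_stepE] identifies
   [cn_mx] with the Crank-Nicolson step of CFL coefficient tau / h^2. *)
Definition cn_mx (R : realType) (m : nat) (s : R) : 'M[R]_m :=
  invmx (cn_M m s) *m cn_N m s.

(* All sums are nonnegative, so the default value 0 only matters when m = 0. *)
Definition mx_norm_inf (R : realType) (m : nat) (A : 'M[R]_m) : R :=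
  \big[Num.max/0]_(i < m) \sum_(j < m) `|A i j|.

Definition mx_norm_one (R : realType) (m : nat) (A : 'M[R]_m) : R :=
  \big[Num.max/0]_(j < m) \sum_(i < m) `|A i j|.

Definition cn_positive (R : realType) (m : nat) (s : R) : Prop :=
  forall i j : 'I_m, 0 <= cn_mx m s i j.

Lemma cn_stepE (R : realType) (m : nat) (tau : R) :
  cn_step m tau = cn_mx m (tau / mesh R m ^+ 2).
Proof.
rewrite /cn_step /cn_mx; congr (invmx _ *m _);
  apply/matrixP => i j; rewrite !mxE; set q := (mesh R m ^+ 2)^-1;
  by case: (i == j); rewrite ?mulr1n ?mulr0n;
    [|case: ifP => _; [|case: ifP => _]]; field.
Qed.

Lemma cn_M_unit (R : realType) (m : nat) (s : R) :
  0 < s -> cn_M m s \in unitmx.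
Proof.
move=> s0; rewrite -row_free_unit; apply: inj_row_free => v vM.
case: m v vM => [v _|m v vM]; first by apply/rowP => -[].
have [k _ kmax] :
    exists2 k : 'I_m.+1, true & forall i, `|v 0 i| <= `|v 0 k|.
  case: (@arg_maxP _ _ _ (ord0 : 'I_m.+1) predT (fun i => `|v 0 i|)) => // k _ h.
  by exists k => // i; exact: h.
have card1 (P : pred 'I_m.+1) : (forall i j, P i -> P j -> i = j) ->
    \sum_(i | P i) `|v 0 i| <= `|v 0 k|.
  move=> P1; case: (pickP P) => [i Pi|P0]; last by rewrite big_pred0.
  rewrite (big_pred1 i) // => j; apply/idP/eqP => [Pj|-> //].
  exact: P1.
have /rowP/(_ k) := vM; rewrite !mxE (bigD1 k) //= !mxE eqxx => /eqP.
rewrite addr_eq0 => /eqP /(congr1 Num.norm); rewrite normrN normrM.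
rewrite (gtr0_norm (_ : 0 < 1 + s)) ?addr_gt0 // => e.
have s2 : 0 < s / 2 by rewrite divr_gt0.
have : `|v 0 k| * (1 + s) <= `|v 0 k| * s.
  rewrite e; apply: (le_trans (ler_norm_sum _ _ _)).
  apply: (@le_trans _ _ (s / 2 * \sum_(i < m.+1 | i == k.+1 :> nat) `|v 0 i|
      + s / 2 * \sum_(i < m.+1 | k == i.+1 :> nat) `|v 0 i|)).
    rewrite !mulr_sumr [X in _ <= X + _]big_mkcond [X in _ <= _ + X]big_mkcond.
    rewrite -big_split /= [leRHS](bigD1 k) //= -[leLHS]add0r lerD //.
      by rewrite addr_ge0 //; case: ifP => // _; rewrite mulr_ge0 // ltW.
    apply: ler_sum => i /negPf ik; rewrite !mxE ik.
    case: ifP => _; last case: ifP => _; last by rewrite mulr0 normr0 addr0.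
      rewrite mulrN normrN normrM (gtr0_norm s2) mulrC lerDl.
      by case: ifP => // _; rewrite mulr_ge0 // ltW.
    by rewrite mulrN normrN normrM (gtr0_norm s2) mulrC add0r.
  have -> : `|v 0 k| * s = s / 2 * `|v 0 k| + s / 2 * `|v 0 k| by field.
  by apply: lerD; rewrite ler_pM2l //; apply: card1 => i j /eqP a /eqP b;
    apply: val_inj; move: b; rewrite /= ?a // => -[].
rewrite mulrDr mulr1 gerDr => vk0.
by apply/rowP => i; rewrite mxE; apply/eqP; rewrite -normr_le0 (le_trans (kmax i)).
Qed.

(* Main.v *)
Require Import Defs.
From mathcomp Require Import all_boot all_order all_algebra.
From mathcomp Require Import reals.
From mathcomp Require Import ring lra.

Import Order.TTheory GRing.Theory Num.Theory.
Local Open Scope ring_scope.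

(** Since [M + N = 2], where [M] and [N] are the implicit and explicit factors
    of the method, [A = M^-1 N = 2 M^-1 - 1].  Two things follow.  First, [A]
    is symmetric because [M] is, so its row sums are also its column sums.
    Secondly, the row sums of [A] are [2 u - 1] with [u = M^-1 1], so they are
    at most 1 as soon as [u <= 1].  That is a discrete maximum principle: [M]
    has nonpositive off-diagonal entries and row sums at least 1
    ([Zmatrix_max_principle], [cn_M_row_sum_ge1]).  When [A] has nonnegative
    entries, its row and column sums are its absolute row and column sums, whose
    maxima are the two norms. *)

(** At an index [k] where [u] is largest, replacing every [u j] by [u k] can
    only decrease [(M u) k], as the off-diagonal weights are nonpositive.  If
    [u k] were above 1, so would be [u k] times the row sum, hence [(M u) k]. *)
Lemma Zmatrix_max_principle (R : realFieldType) (m : nat)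
    (M : 'M[R]_m) (u : 'cV[R]_m) :
  (forall i j, i != j -> M i j <= 0) ->
  (forall i, 1 <= \sum_j M i j) ->
  (forall i, (M *m u) i 0 <= 1) ->
  forall i, u i 0 <= 1.
Proof.
move=> Moff Msum Mu i.
case: (@arg_maxP _ _ _ i predT (fun j => u j 0)) => // k _ kmax.
apply: le_trans (kmax i isT) _; rewrite leNgt; apply/negP => uk.
have : u k 0 * \sum_j M k j <= (M *m u) k 0.
  rewrite mxE mulr_sumr; apply: ler_sum => j _; rewrite mulrC.
  have [->//|kj] := eqVneq j k.
  by apply: ler_wnM2l; [apply: Moff; rewrite eq_sym | exact: kmax].
have := Msum k; have := Mu k; nra.
Qed.

Lemma cn_ME (R : realType) (m : nat) (s : R) (i j : 'I_m) :
  cn_M m s i j = (1 + s) * (i == j)%:R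
    - s / 2 * (i == j.+1 :> nat)%:R - s / 2 * (j == i.+1 :> nat)%:R.
Proof.
rewrite mxE; have [->|_] := eqVneq i j; first by rewrite ltn_eqF //=; ring.
have [->|_] := eqVneq (i : nat) j.+1; first by rewrite ltn_eqF //=; ring.
by case: ifP => _ /=; ring.
Qed.

Lemma trmx_cn_M (R : realType) (m : nat) (s : R) : (cn_M m s)^T = cn_M m s.
Proof. by apply/matrixP => i j; rewrite mxE !cn_ME eq_sym; ring. Qed.

(** Each index has at most one left and one right neighbour, and they remove at
    most [s / 2] each from the diagonal entry [1 + s]. *)
Lemma cn_M_row_sum_ge1 (R : realType) (m : nat) (s : R) (i : 'I_m) :
  0 < s -> 1 <= \sum_j cn_M m s i j.
Proof.
move=> s0; under eq_bigr => j _ do rewrite cn_ME.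
have indicator1 (P : pred 'I_m) : (forall j k, P j -> P k -> j = k) ->
    \sum_j (P j)%:R <= 1 :> R.
  move=> P1; case: (pickP P) => [j Pj|P0]; last first.
    by rewrite big1 // => j _; rewrite P0.
  rewrite (bigD1 j) //= Pj big1 ?addr0 // => k /eqP kj.
  by case: (boolP (P k)) => // Pk; case: kj; exact: P1.
rewrite !sumrB -!mulr_sumr (bigD1 i) //= eqxx big1 ?addr0; last first.
  by move=> j /negPf; rewrite eq_sym => ->.
have drop_le (a b : R) : a <= 1 -> b <= 1 ->
    1 <= (1 + s) * 1 - s / 2 * a - s / 2 * b by nra.
apply: drop_le; apply: indicator1 => j k /eqP ij /eqP ik; apply: val_inj.
  by move: ik; rewrite /= ij => -[].
by rewrite /= ij ik.
Qed.

Lemma cn_mxE (R : realType) (m : nat) (s : R) :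
  0 < s -> cn_mx m s = 2 *: invmx (cn_M m s) - 1%:M.
Proof.
move=> s0; have -> : cn_mx m s = invmx (cn_M m s) *m (2%:M - cn_M m s).
  congr (_ *m _); apply/matrixP => i j; rewrite !mxE.
  by case: (i == j); [|case: ifP => _; [|case: ifP => _]];
    rewrite ?mulr1n ?mulr0n; ring.
by rewrite mulmxBr mulVmx ?cn_M_unit // mul_mx_scalar.
Qed.

Lemma trmx_cn_mx (R : realType) (m : nat) (s : R) :
  0 < s -> (cn_mx m s)^T = cn_mx m s.
Proof.
by move=> s0; rewrite cn_mxE // linearB linearZ /= trmx_inv trmx_cn_M tr_scalar_mx.
Qed.

Lemma cn_mx_row_sum_le1 (R : realType) (m : nat) (s : R) (i : 'I_m) :
  0 < s -> \sum_j cn_mx m s i j <= 1.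
Proof.
move=> s0; pose u : 'cV[R]_m := invmx (cn_M m s) *m const_mx 1.
have -> : \sum_j cn_mx m s i j = 2 * u i 0 - 1.
  transitivity ((cn_mx m s *m (const_mx 1 : 'cV_m)) i 0).
    by rewrite mxE; apply: eq_bigr => j _; rewrite [const_mx _ _ _]mxE mulr1.
  by rewrite cn_mxE // mulmxBl -scalemxAl mul1mx 2!mxE [in RHS]/u !mxE.
suff : u i 0 <= 1 by lra.
apply: (@Zmatrix_max_principle _ _ (cn_M m s)) => [j k jk|j|j].
- rewrite cn_ME (negPf jk) mulr0.
  have : 0 <= (j == k.+1 :> nat)%:R :> R by [].
  have : 0 <= (k == j.+1 :> nat)%:R :> R by [].
  nra.
- exact: cn_M_row_sum_ge1.
- by rewrite mulmxA mulmxV ?cn_M_unit // mul1mx mxE.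
Qed.

Theorem corollary1 (R : realType) (m : nat) (s : R)
    (hm : (0 < m)%N) (hs : 0 < s) (hpos : cn_positive m s) :
  mx_norm_inf (cn_mx m s) <= 1 /\ mx_norm_one (cn_mx m s) <= 1.
Proof.
have row_le1 i : \sum_j `|cn_mx m s i j| <= 1.
  under eq_bigr => j _ do rewrite ger0_norm ?hpos //.
  exact: cn_mx_row_sum_le1.
split; apply: bigmax_le => // i _.
by under eq_bigr => j _ do rewrite -trmx_cn_mx // mxE.
Qed.
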